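(* Let $\mathcal{I}=\left((\mathrm{E}_n)_{n\in\mathbb{N}},(p_{m,n})_{m\ge n}\right)$ be an inverse system in $\mathbf{IVL}$, and let $\mathcal{S}=\left(\mathrm{E},(p_n)_{n\in\mathbb{N}}\right)$ be the inverse limit of $\mathcal{I}$ in $\mathbf{VL}$. Assume that $p_{m,n}$ is a surjection for all $m\ge n$ in $\mathbb{N}$. Let $\mathcal{I}^\sim=\left((\mathrm{E}_n^\sim)_{n\in\mathbb{N}},(p_{m,n}^\sim)_{m\ge n}\right)$ be the dual system. Then the following statements are true. (i) The direct limit $\varinjlim\mathcal{I}^\sim=\left(\mathrm{F},(e_n)_{n\in\mathbb{N}}\right)$ exists in $\mathbf{NIVL}$. (ii) $(\varprojlim\mathcal{I})^\sim\cong\varinjlim\mathcal{I}^\sim$ in $\mathbf{NIVL}$; that is, there exists a lattice isomorphism $T:\mathrm{F}\to\mathrm{E}^\sim$ such that $T\circ e_n=p_n^\sim$ for all $n\in\mathbb{N}$.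
   Context: All vector lattices are real. A linear map between vector lattices is a lattice homomorphism if it preserves finite suprema and infima; it is normal if it is moreover order continuous. A positive $T:\mathrm{E}\to\mathrm{F}$ is interval preserving if $T[[0,u]]=[0,T(u)]$ for all $0\le u\in\mathrm{E}$. The categories $\mathbf{VL}$, $\mathbf{IVL}$, $\mathbf{NIVL}$ have vector lattices as objects; morphisms are, respectively, lattice homomorphisms, interval preserving lattice homomorphisms, and normal interval preserving lattice homomorphisms. $\mathrm{E}^\sim$ is the vector lattice of order bounded linear functionals on $\mathrm{E}$; for a positive operator $T:\mathrm{E}\to\mathrm{F}$, $T^\sim:\mathrm{F}^\sim\to\mathrm{E}^\sim$ is $\varphi\mapsto\varphi\circ T$. An inverse system in a category $\mathbf{C}$ (here over $\mathbb{N}$) consists of vector lattices $\mathrm{E}_n$ and $\mathbf{C}$-morphisms $p_{m,n}:\mathrm{E}_m\to\mathrm{E}_n$ ($m\ge n$) with $p_{m,n}\circ p_{k,m}=p_{k,n}$ for $n\le m\le k$; compatible systems $(\mathrm{E},(p_n:\mathrm{E}\to\mathrm{E}_n))$ of $\mathbf{C}$-morphisms satisfy $p_{m,n}\circ p_m=p_n$, and the inverse limit in $\mathbf{C}$ is a compatible system through which every compatible system $(\tilde{\mathrm{E}},(\tilde p_n))$ factors via a unique $\mathbf{C}$-morphism $s:\tilde{\mathrm{E}}\to\mathrm{E}$, $p_n\circ s=\tilde p_n$. In $\mathbf{VL}$ it always exists and is realised as $\{(u_n)\in\prod\mathrm{E}_n: p_{m,n}(u_m)=u_n \text{ for } m\ge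 n\}$ with $p_n$ the restricted coordinate projections. A direct system in $\mathbf{C}$ consists of vector lattices $\mathrm{G}_n$ and $\mathbf{C}$-morphisms $e_{n,m}:\mathrm{G}_n\to\mathrm{G}_m$ ($n\le m$) with $e_{m,k}\circ e_{n,m}=e_{n,k}$; compatible systems $(\mathrm{G},(e_n:\mathrm{G}_n\to\mathrm{G}))$ of $\mathbf{C}$-morphisms satisfy $e_m\circ e_{n,m}=e_n$, and the direct limit in $\mathbf{C}$ is a compatible system such that for each compatible system $(\tilde{\mathrm{G}},(\tilde e_n))$ there is a unique $\mathbf{C}$-morphism $r:\mathrm{G}\to\tilde{\mathrm{G}}$ with $r\circ e_n=\tilde e_n$ for all $n$. The dual system $\mathcal{I}^\sim$, with maps $p_{m,n}^\sim:\mathrm{E}_n^\sim\to\mathrm{E}_m^\sim$, is a direct system in $\mathbf{NIVL}$. *)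

(* Defs.v *)
From HB Require Import structures.
From mathcomp Require Import all_boot all_order all_algebra.
From mathcomp Require Import boolp classical_sets functions set_interval reals.

Set Implicit Arguments.
Unset Strict Implicit.
Unset Printing Implicit Defensive.

Import Order.TTheory GRing.Theory Num.Theory.

Local Open Scope classical_set_scope.
Local Open Scope ring_scope.

(* Num.RealDomain, being declared upstream, prevents Hierarchy Builder from
   joining Order.Lattice with an algebraic structure: the lattice operations are
   therefore fields of the mixin, and vector lattices get their Order.Lattice
   structure from the instance that follows. *)
HB.mixin Record isVectorLattice (R : realType) E
    of GRing.Lmodule R E & Num.POrderedZmodule E := {
  vl_meet : E -> E -> E;
  vl_join : E -> E -> E;
  vl_lexI : forall x y z : E, (x <= vl_meet y z) = (x <= y) && (x <= z);
  vl_leUx : forall x y z : E, (vl_join x y <= z) = (x <= z) && (y <= z);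
  vl_leD2r : forall z x y : E, x <= y -> x + z <= y + z;
  vl_scaler_ge0 : forall (a : R) (x : E), 0 <= a -> 0 <= x -> 0 <= a *: x }.

#[short(type="vectorLatticeType")]
HB.structure Definition VectorLattice (R : realType) :=
  { E of GRing.Lmodule R E & Num.POrderedZmodule E & isVectorLattice R E }.

HB.instance Definition _ (R : realType) (E : vectorLatticeType R) :=
  Order.POrder_MeetJoin_isLattice.Build ring_display (VectorLattice.sort E)
    (@vl_lexI R E) (@vl_leUx R E).

Section VectorLatticeTheory.
Variables (R : realType) (E : vectorLatticeType R).
Implicit Types x y z u v : E.

Definition vl_abs x : E := (x `|` - x)%O.
Definition vl_pos x : E := (x `|` 0)%O.

Lemma vl_leD2rE z x y : (x + z <= y + z) = (x <= y).
Proof.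
apply/idP/idP => [|/vl_leD2r//].
by move=> /(vl_leD2r (- z)); rewrite !addrK.
Qed.

Lemma vl_subr_ge0 x y : (0 <= y - x) = (x <= y).
Proof. by rewrite -(vl_leD2rE x 0) add0r subrK. Qed.

Lemma vl_leD x y u v : x <= y -> u <= v -> x + u <= y + v.
Proof.
move=> xy uv; apply: (@le_trans _ _ (y + u)); first exact: vl_leD2r.
by rewrite ![y + _]addrC; exact: vl_leD2r.
Qed.

Lemma vl_addr_ge0 x y : 0 <= x -> 0 <= y -> 0 <= x + y.
Proof. by move=> x0 y0; rewrite -[0]addr0; exact: vl_leD. Qed.

Lemma vl_pos_ge0 x : 0 <= vl_pos x.
Proof. exact: leUr. Qed.

Lemma vl_posB x : vl_pos x - vl_pos (- x) = x.
Proof.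
suff -> : vl_pos x = vl_pos (- x) + x by rewrite addrAC subrr add0r.
apply/le_anti/andP; split.
  rewrite leUx -{1}[x]add0r vl_leD2r ?vl_pos_ge0//=.
  by rewrite -(vl_leD2rE (- x)) addrK add0r leUl.
rewrite -(vl_leD2rE (- x)) addrK leUx.
rewrite -{1}[- x]add0r vl_leD2r ?vl_pos_ge0//=.
by rewrite vl_subr_ge0 leUl.
Qed.

Lemma vl_riesz x y z : 0 <= x -> 0 <= y -> 0 <= z -> z <= x + y ->
  exists z1 z2, [/\ 0 <= z1 <= x, 0 <= z2 <= y & z = z1 + z2].
Proof.
move=> x0 y0 z0 zxy; exists (z `&` x)%O, (z - (z `&` x)%O).
split; last by rewrite addrC subrK.
- by rewrite lexI z0 x0 leIr.
- rewrite vl_subr_ge0 leIl /=.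
  rewrite -(vl_leD2rE (z `&` x)%O) subrK addrC -(vl_leD2rE (- y)) addrK lexI.
  rewrite -(vl_leD2rE y (z - y) z) -(vl_leD2rE y (z - y) x) subrK zxy andbT.
  by rewrite -{1}[z]addr0 vl_leD.
Qed.

End VectorLatticeTheory.

Section OrderDual.
Variables (R : realType) (E : vectorLatticeType R).
Implicit Types (x y u v : E).

Definition order_bounded_functional (f : E -> R) :=
  forall u v, exists a b : R, f @` `[u, v] `<=` `[a, b].

Definition order_dual_pred : {pred E -> R^o} :=
  fun f => `[< scalar f /\ order_bounded_functional f >].

Lemma order_dual_submod_closed : submod_closed order_dual_pred.
Proof.
split.
  apply/asboolP; split; first by move=> a x y; rewrite /= mulr0 addr0.
  by move=> u v; exists 0, 0 => _ [x _ <-]; rewrite /= in_itv /= lexx.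
move=> k f g /asboolP[fl fb] /asboolP[gl gb]; apply/asboolP; split.
  move=> a x y; rewrite !fctE fl gl /GRing.scale /=.
  by rewrite /GRing.scale /= !mulrDr mulrCA addrACA.
move=> u v; have [a [b fab]] := fb u v; have [c [d gcd]] := gb u v.
pose M := `|k| * (`|a| + `|b|) + (`|c| + `|d|).
exists (- M), M => _ [x xuv <-].
have := fab _ (imageP f xuv); have := gcd _ (imageP g xuv).
rewrite /= !in_itv /= -ler_norml => /andP[cg gd] /andP[af fb'].
have norm_le (s t r : R) : s <= r -> r <= t -> `|r| <= `|s| + `|t|.
  move=> sr rt; rewrite ler_norml; apply/andP; split.
    apply: le_trans sr; rewrite lerNl; apply: le_trans (ler_norm _) _.
    by rewrite normrN lerDl.
  by apply: le_trans rt _; apply: le_trans (ler_norm _) _; rewrite lerDr.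
apply: le_trans (ler_normD _ _) _; rewrite normrM lerD ?norm_le//.
by rewrite ler_wpM2l ?norm_le.
Qed.

HB.instance Definition _ :=
  GRing.isSubmodClosed.Build R (E -> R^o) order_dual_pred
    order_dual_submod_closed.

Record order_dual := OrderDual {
  order_dual_val :> E -> R^o ;
  order_dual_valP : order_dual_val \in order_dual_pred }.

HB.instance Definition _ := [isSub for order_dual_val].
HB.instance Definition _ := [Choice of order_dual by <:].
HB.instance Definition _ := [SubChoice_isSubLmodule of order_dual by <:].

Implicit Types f g h : order_dual.

Lemma order_dual_scalar f : scalar f.
Proof. by have /asboolP[] := order_dual_valP f. Qed.

Lemma order_dual_bounded f : order_bounded_functional f.
Proof. by have /asboolP[] := order_dual_valP f. Qed.

Lemma order_dualD f x y : f (x + y) = f x + f y.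
Proof. by have := order_dual_scalar f 1 x y; rewrite scale1r mul1r. Qed.

Lemma order_dual0 f : f 0 = 0.
Proof. by apply: (@addrI _ (f 0)); rewrite -order_dualD !addr0. Qed.

Lemma order_dualZ f (a : R) x : f (a *: x) = a * f x.
Proof.
by have := order_dual_scalar f a x 0; rewrite !addr0 order_dual0 addr0.
Qed.

Lemma order_dualN f x : f (- x) = - f x.
Proof. by rewrite -scaleN1r order_dualZ mulN1r. Qed.

Lemma order_dualB f x y : f (x - y) = f x - f y.
Proof. by rewrite order_dualD order_dualN. Qed.

Definition order_dual_le f g := `[< forall x, 0 <= x -> f x <= g x :> R >].

Lemma order_dual_le_refl : reflexive order_dual_le.
Proof. by move=> f; apply/asboolP. Qed.

Lemma order_dual_le_anti : antisymmetric order_dual_le.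
Proof.
move=> f g /andP[/asboolP fg /asboolP gf]; apply/val_inj/funext => x /=.
have eq0 u : 0 <= u -> f u = g u.
  by move=> u0; apply/le_anti; rewrite fg ?gf.
by rewrite -(vl_posB x) !order_dualB !eq0 ?vl_pos_ge0.
Qed.

Lemma order_dual_le_trans : transitive order_dual_le.
Proof.
move=> g f h /asboolP fg /asboolP gh; apply/asboolP => x x0.
exact: le_trans (fg x x0) (gh x x0).
Qed.

HB.instance Definition _ :=
  Order.Le_isPOrder.Build ring_display order_dual
    order_dual_le_refl order_dual_le_anti order_dual_le_trans.

Lemma order_dual_leP f g :
  reflect (forall x, 0 <= x -> f x <= g x :> R) (f <= g).
Proof. exact: asboolP. Qed.

Lemma order_dual_leD2r h f g : f <= g -> f + h <= g + h.
Proof.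
move=> /order_dual_leP fg; apply/order_dual_leP => x x0.
by rewrite lerD2r; exact: fg.
Qed.

Lemma order_dual_scaler_ge0 (a : R) f : 0 <= a -> 0 <= f -> 0 <= a *: f.
Proof.
move=> a0 /order_dual_leP f0; apply/order_dual_leP => x x0.
by apply: mulr_ge0 => //; exact: f0.
Qed.

(* Riesz-Kantorovich: the positive part of [f] is the linear extension of
   [x |-> sup {f y : 0 <= y <= x}] from the positive cone. *)
Definition rk_cone f x : R := sup ((f : E -> R) @` `[0, x]).
Definition rk_fun f x : R := rk_cone f (vl_pos x) - rk_cone f (vl_pos (- x)).

Lemma rk_cone_ub f x y : 0 <= y -> y <= x -> f y <= rk_cone f x.
Proof.
move=> y0 yx; apply: ub_le_sup; last by exists y; rewrite //= in_itv /= y0.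
have [a [b fab]] := order_dual_bounded f 0 x.
by exists b => r /fab; rewrite /= in_itv /= => /andP[].
Qed.

Lemma rk_cone_le f x r : 0 <= x ->
  (forall y, 0 <= y -> y <= x -> f y <= r) -> rk_cone f x <= r.
Proof.
move=> x0 H; apply: ge_sup.
  by exists (f 0), 0 => //=; rewrite in_itv /= lexx.
by move=> _ [y + <-]; rewrite /= in_itv /= => /andP[]; exact: H.
Qed.

Lemma rk_cone_ge0 f x : 0 <= x -> 0 <= rk_cone f x.
Proof. by move=> x0; rewrite -(order_dual0 f) rk_cone_ub. Qed.

Lemma rk_coneD f x y : 0 <= x -> 0 <= y ->
  rk_cone f (x + y) = rk_cone f x + rk_cone f y.
Proof.
move=> x0 y0; apply/le_anti/andP; split.
  apply: rk_cone_le => [|z z0 zxy]; first exact: vl_addr_ge0.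
  have [z1 [z2 [/andP[z10 z1x] /andP[z20 z2y] ->]]] := vl_riesz x0 y0 z0 zxy.
  by rewrite order_dualD lerD// rk_cone_ub.
rewrite -lerBrDr; apply: rk_cone_le => // u u0 ux.
rewrite lerBrDr addrC -lerBrDr; apply: rk_cone_le => // v v0 vy.
by rewrite lerBrDr -order_dualD rk_cone_ub ?vl_addr_ge0// addrC vl_leD.
Qed.

Lemma rk_coneZ f (a : R) x : 0 <= a -> 0 <= x ->
  rk_cone f (a *: x) = a * rk_cone f x.
Proof.
have leZ (b : R) u v : 0 <= b -> u <= v -> b *: u <= b *: v.
  by move=> b0 uv; rewrite -vl_subr_ge0 -scalerBr vl_scaler_ge0// vl_subr_ge0.
have half (b : R) u : 0 < b -> 0 <= u ->
    rk_cone f (b *: u) <= b * rk_cone f u.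
  move=> b0 u0; apply: rk_cone_le => [|y y0 yu].
    by rewrite vl_scaler_ge0 // ltW.
  rewrite -[y](@scalerKV _ _ b) ?gt_eqF// order_dualZ ler_pM2l// rk_cone_ub//.
    by rewrite vl_scaler_ge0 // invr_ge0 ltW.
  by rewrite -[u](@scalerK _ _ b) ?gt_eqF// leZ// invr_ge0 ltW.
rewrite le_eqVlt => /predU1P[<- x0|a0 x0].
  rewrite scale0r mul0r; apply/le_anti; rewrite rk_cone_ge0// andbT.
  apply: rk_cone_le => // y y0 yle0.
  by rewrite (_ : y = 0) ?order_dual0//; apply/le_anti; rewrite y0 yle0.
apply/le_anti; rewrite half//= -ler_pdivlMl//.
rewrite -{1}[x](@scalerK _ _ a) ?gt_eqF// half ?invr_gt0//.
by rewrite vl_scaler_ge0// ltW.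
Qed.

Lemma rk_funB f x y : 0 <= x -> 0 <= y ->
  rk_fun f (x - y) = rk_cone f x - rk_cone f y.
Proof.
move=> x0 y0; apply/eqP.
rewrite /rk_fun subr_eq addrAC eq_sym subr_eq; apply/eqP.
rewrite -!rk_coneD ?vl_pos_ge0//; congr rk_cone.
have /eqP := vl_posB (x - y); rewrite subr_eq addrAC eq_sym subr_eq.
by move=> /eqP ->.
Qed.

Lemma rk_fun_cone f x : 0 <= x -> rk_fun f x = rk_cone f x.
Proof.
move=> x0; rewrite -[in LHS](subr0 x) rk_funB//.
by rewrite -[X in _ - rk_cone _ X](scale0r (0 : E)) rk_coneZ// mul0r subr0.
Qed.

Lemma rk_fun_scalar f : scalar (rk_fun f).
Proof.
have rkN x : rk_fun f (- x) = - rk_fun f x by rewrite /rk_fun opprK opprB.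
have rkD x y : rk_fun f (x + y) = rk_fun f x + rk_fun f y.
  rewrite -[in LHS](vl_posB x) -[in LHS](vl_posB y) addrACA -opprD.
  rewrite rk_funB ?vl_addr_ge0 ?vl_pos_ge0// !rk_coneD ?vl_pos_ge0//.
  by rewrite opprD addrACA.
have rkZ (a : R) x : 0 <= a -> rk_fun f (a *: x) = a * rk_fun f x.
  move=> a0; rewrite -[in LHS](vl_posB x) scalerBr.
  rewrite rk_funB ?vl_scaler_ge0 ?vl_pos_ge0// !rk_coneZ ?vl_pos_ge0//.
  by rewrite -mulrBr.
move=> a x y; rewrite rkD; congr (_ + _).
have [a0|/ltW a0] := leP 0 a; first exact: rkZ.
by rewrite -[a]opprK scaleNr rkN rkZ ?oppr_ge0// !mulNr.
Qed.

Lemma rk_fun_order_dual f : rk_fun f \in order_dual_pred.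
Proof.
apply/asboolP; split; first exact: rk_fun_scalar.
have mono u v : u <= v -> rk_fun f u <= rk_fun f v.
  move=> uv; have := rk_fun_scalar f 1 (v - u) u.
  rewrite scale1r subrK mul1r => ->.
  by rewrite lerDr rk_fun_cone ?rk_cone_ge0 ?vl_subr_ge0.
move=> u v; exists (rk_fun f u), (rk_fun f v) => _ [x + <-].
by rewrite /= !in_itv /= => /andP[ux xv]; rewrite !mono.
Qed.

Definition order_dual_pos f : order_dual := OrderDual (rk_fun_order_dual f).

Lemma order_dual_pos_ge f : f <= order_dual_pos f.
Proof.
by apply/order_dual_leP => x x0; rewrite /= rk_fun_cone// rk_cone_ub.
Qed.

Lemma order_dual_pos_ge0 f : 0 <= order_dual_pos f.
Proof.
by apply/order_dual_leP => x x0; rewrite /= rk_fun_cone// rk_cone_ge0.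
Qed.

Lemma order_dual_pos_le f h : f <= h -> 0 <= h -> order_dual_pos f <= h.
Proof.
move=> /order_dual_leP fh /order_dual_leP h0; apply/order_dual_leP => x x0.
rewrite /= rk_fun_cone//; apply: rk_cone_le => // y y0 yx.
apply: le_trans (fh y y0) _; rewrite -subr_ge0 -order_dualB.
by apply: h0; rewrite vl_subr_ge0.
Qed.

Definition order_dual_join f g := order_dual_pos (f - g) + g.
Definition order_dual_meet f g := - order_dual_join (- f) (- g).

Lemma order_dual_leUx f g h :
  (order_dual_join f g <= h) = (f <= h) && (g <= h).
Proof.
apply/idP/andP => [fgh|[fh gh]]; [split; apply: le_trans fgh|].
- by have := order_dual_leD2r g (order_dual_pos_ge (f - g)); rewrite subrK.
- by have := order_dual_leD2r g (order_dual_pos_ge0 (f - g)); rewrite add0r.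
- rewrite -[h](subrK g); apply: order_dual_leD2r; apply: order_dual_pos_le.
    exact: order_dual_leD2r.
  by rewrite -(subrr g); exact: order_dual_leD2r.
Qed.

Lemma order_dual_lexI f g h :
  (f <= order_dual_meet g h) = (f <= g) && (f <= h).
Proof.
have leN (u v : order_dual) : (u <= - v) = (v <= - u).
  suff imp (a b : order_dual) : a <= - b -> b <= - a.
    by apply/idP/idP; exact: imp.
  move=> /(order_dual_leD2r (b - a)).
  by rewrite addrCA subrr addr0 addrA addNr add0r.
by rewrite leN order_dual_leUx -!(leN f) !opprK.
Qed.

HB.instance Definition _ :=
  Order.POrder_MeetJoin_isLattice.Build ring_display order_dual
    order_dual_lexI order_dual_leUx.

HB.instance Definition _ :=
  isVectorLattice.Build R order_dual order_dual_lexI order_dual_leUx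
    order_dual_leD2r order_dual_scaler_ge0.

End OrderDual.

Section Operators.
Variables (R : realType) (E F : vectorLatticeType R).
Implicit Types T : E -> F.

Definition positive_operator T :=
  linear T /\ forall x : E, 0 <= x -> 0 <= T x.

Definition interval_preserving T :=
  positive_operator T /\
  forall u : E, 0 <= u -> T @` `[0, u] = [set` `[0, T u]].

Definition lattice_homomorphism T :=
  [/\ linear T, Order.meet_morphism T & Order.join_morphism T].

Definition lattice_isomorphism T := lattice_homomorphism T /\ bijective T.

Definition decreases_to_zero (A : set E) :=
  [/\ A !=set0,
      forall x y, A x -> A y -> exists z, [/\ A z, z <= x & z <= y]
    & infimums A 0].

Definition order_continuous T :=
  forall A : set E, decreases_to_zero A ->
    infimums [set vl_abs (T u) | u in A] 0.

(* The map [phi |-> phi \o T].  It has the junk value 0 where [phi \o T] is not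
   an order bounded linear functional, which cannot happen for positive [T]:
   see [adjointE]. *)
Definition adjoint T (phi : order_dual F) : order_dual E :=
  insubd 0 ((phi : F -> R^o) \o T).

Lemma adjointE T phi : positive_operator T ->
  adjoint T phi = (phi : F -> R^o) \o T :> (E -> R^o).
Proof.
move=> [Tlin Tpos]; rewrite /adjoint -[LHS]/(val _) val_insubd ifT//.
apply/asboolP; split.
  by move=> a x y; rewrite /= Tlin order_dual_scalar.
have mono (x y : E) : x <= y -> T x <= T y.
  move=> xy; have := Tlin 1 (y - x) x.
  rewrite !scale1r subrK => ->; rewrite -{1}[T x]add0r.
  by apply: vl_leD2r; apply: Tpos; rewrite vl_subr_ge0.
move=> u v; have [a [b fab]] := order_dual_bounded phi (T u) (T v).
exists a, b => _ [x + <-]; rewrite /= in_itv /= => /andP[ux xv].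
by apply: fab; exists (T x) => //; rewrite /= in_itv /= !mono.
Qed.

Lemma lattice_homomorphism_positive T :
  lattice_homomorphism T -> positive_operator T.
Proof.
move=> [Tlin TI TU]; split => // x x0.
have T0 : T 0 = 0.
  by have := Tlin (-1) 0 0; rewrite scaler0 addr0 scaleN1r addNr.
by rewrite -T0 leEmeet -TI; move: x0; rewrite leEmeet => /eqP ->.
Qed.

End Operators.

Definition morphism_class (R : realType) :=
  forall E F : vectorLatticeType R, (E -> F) -> Prop.

Definition VL (R : realType) : morphism_class R :=
  fun E F T => lattice_homomorphism T.

Definition IVL (R : realType) : morphism_class R :=
  fun E F T => lattice_homomorphism T /\ interval_preserving T.

Definition NIVL (R : realType) : morphism_class R :=
  fun E F T =>
    [/\ lattice_homomorphism T, order_continuous T & interval_preserving T].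

Arguments VL {R}.
Arguments IVL {R}.
Arguments NIVL {R}.

Section InverseSystems.
Variables (R : realType) (C : morphism_class R).
Variables (E : nat -> vectorLatticeType R).
Variable p : forall m n, (n <= m)%N -> E m -> E n.

Definition inverse_system :=
  (forall m n (nm : (n <= m)%N), C (p nm)) /\
  (forall n m k (nm : (n <= m)%N) (mk : (m <= k)%N),
     p nm \o p mk = p (leq_trans nm mk)).

Definition inverse_compatible (L : vectorLatticeType R)
    (q : forall n, L -> E n) :=
  (forall n, C (q n)) /\
  (forall m n (nm : (n <= m)%N), p nm \o q m = q n).

Definition is_inverse_limit (L : vectorLatticeType R)
    (q : forall n, L -> E n) :=
  [/\ inverse_system, inverse_compatible q
    & forall (L' : vectorLatticeType R) (q' : forall n, L' -> E n),
        inverse_compatible q' ->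
        exists! s : L' -> L, C s /\ forall n, q n \o s = q' n].

End InverseSystems.

Section DirectSystems.
Variables (R : realType) (C : morphism_class R).
Variables (G : nat -> vectorLatticeType R).
Variable e : forall n m, (n <= m)%N -> G n -> G m.

Definition direct_system :=
  (forall n m (nm : (n <= m)%N), C (e nm)) /\
  (forall n m k (nm : (n <= m)%N) (mk : (m <= k)%N),
     e mk \o e nm = e (leq_trans nm mk)).

Definition direct_compatible (L : vectorLatticeType R)
    (f : forall n, G n -> L) :=
  (forall n, C (f n)) /\
  (forall n m (nm : (n <= m)%N), f m \o e nm = f n).

Definition is_direct_limit (L : vectorLatticeType R)
    (f : forall n, G n -> L) :=
  [/\ direct_system, direct_compatible f
    & forall (L' : vectorLatticeType R) (f' : forall n, G n -> L'),
        direct_compatible f' ->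
        exists! r : L -> L', C r /\ forall n, r \o f n = f' n].

End DirectSystems.

Section DualSystem.
Variables (R : realType) (E : nat -> vectorLatticeType R).
Variable p : forall m n, (n <= m)%N -> E m -> E n.

Definition dual_obj (n : nat) : vectorLatticeType R := order_dual (E n).

Definition dual_map n m (nm : (n <= m)%N) : dual_obj n -> dual_obj m :=
  adjoint (p nm).

End DualSystem.

(* Main.v *)
(* The order dual of E, with the adjoints of the limit maps p n, is itself the
   direct limit. Since the transition maps are surjective and interval
   preserving, recursive lifting shows that so are the p n, and hence the
   adjoints are injective, interval preserving lattice homomorphisms; injectivity
   makes them order continuous. They jointly cover the dual of E: a positive
   functional phi must vanish on the kernel of some p n, for otherwise one picks
   0 <= x_n in ker (p n) with phi x_n = 1, and the coordinatewise finite sum of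
   the x_n is an element on which phi exceeds every integer. Thus the dual of E
   is an increasing union of ideals that are copies of the duals of the E_ n, and
   such a union is a direct limit. *)

Require Import Defs.
From HB Require Import structures.
From mathcomp Require Import all_boot all_order all_algebra.
From mathcomp Require Import boolp classical_sets functions set_interval reals.

Set Implicit Arguments.
Unset Strict Implicit.
Unset Printing Implicit Defensive.

Import Order.TTheory GRing.Theory Num.Theory.

Local Open Scope classical_set_scope.
Local Open Scope ring_scope.

(** * Positive parts and absolute values *)

Section VectorLattices.
Variables (R : realType) (E : vectorLatticeType R).
Implicit Types x : E.

Lemma vl_pos_id x : 0 <= x -> vl_pos x = x.
Proof. by move=> x0; rewrite /vl_pos; exact/join_l. Qed.

Lemma vl_abs_id x : 0 <= x -> vl_abs x = x.
Proof.
move=> x0; rewrite /vl_abs; apply/join_l; apply: (le_trans _ x0).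
by rewrite -(vl_leD2rE x) addNr add0r.
Qed.

Lemma vl_abs_ge x : x <= vl_abs x.
Proof. exact: leUl. Qed.

Lemma vl_abs_geN x : - x <= vl_abs x.
Proof. exact: leUr. Qed.

Lemma vl_abs_ge0 x : 0 <= vl_abs x.
Proof.
have h : 0 <= (2%:R : R) *: vl_abs x.
  rewrite scaler_nat mulr2n -(subrr x).
  exact: vl_leD (vl_abs_ge x) (vl_abs_geN x).
rewrite -(@scalerK _ _ (2%:R : R) _ (vl_abs x)) ?pnatr_eq0//.
by rewrite vl_scaler_ge0// invr_ge0 ler0n.
Qed.

Lemma decreases_to_zero_ge0 (A : set E) x :
  decreases_to_zero A -> A x -> 0 <= x.
Proof. by move=> [_ _ [lb _]]; exact: lb. Qed.

End VectorLattices.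

(** * Lattice homomorphisms, order intervals and order continuity *)

Section LatticeHomomorphisms.
Variables (R : realType) (E F : vectorLatticeType R).
Implicit Types (x y u v : E) (T : E -> F).

(** Operators are bare functions with a linearity predicate; bundling them gives access to rewriting
    lemmas such as [raddfB] and [linearZ]. *)
Lemma linear_bundle T : linear T -> exists L : {linear E -> F}, T = L.
Proof.
move=> Tlin.
pose M := GRing.isLinear.Build R E F _ T Tlin.
by pose L : {linear E -> F} := HB.pack T M; exists L.
Qed.

Lemma lattice_hom_vl_pos T x :
  lattice_homomorphism T -> T (vl_pos x) = vl_pos (T x).
Proof.
by move=> [/linear_bundle[L ->] _ TU]; rewrite /vl_pos TU raddf0.
Qed.

Lemma lattice_hom_vl_abs T x :
  lattice_homomorphism T -> T (vl_abs x) = vl_abs (T x).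
Proof.
by move=> [/linear_bundle[L ->] _ TU]; rewrite /vl_abs TU raddfN.
Qed.

Lemma lattice_hom_le T x y : lattice_homomorphism T -> x <= y -> T x <= T y.
Proof. by move=> [_ TI _] /meet_idPl xy; apply/meet_idPl; rewrite -TI xy. Qed.

(** In a lattice [x <= y] is an equation about the meet, which an injective homomorphism
    reflects. *)
Lemma lattice_hom_inj_le T x y :
  lattice_homomorphism T -> injective T -> (T x <= T y) = (x <= y).
Proof.
move=> Thom Tinj; apply/idP/idP; last exact: lattice_hom_le.
case: Thom => _ TI _ /meet_idPl; rewrite -TI => /Tinj xy.
exact/meet_idPl.
Qed.

Lemma interval_preserving_lift T u (w : F) :
  interval_preserving T -> 0 <= u -> 0 <= w -> w <= T u ->
  exists v, [/\ 0 <= v, v <= u & T v = w].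
Proof.
move=> [_ Tint] u0 w0 wu.
have : [set` `[0, T u]] w by rewrite /= in_itv /= w0.
by rewrite -Tint// => -[v]; rewrite /= in_itv /= => /andP[v0 vu] <-; exists v.
Qed.

Lemma interval_preservingP T : positive_operator T ->
  (forall u (w : F), 0 <= u -> 0 <= w -> w <= T u ->
     exists v, [/\ 0 <= v, v <= u & T v = w]) ->
  interval_preserving T.
Proof.
move=> Tpos lift; split=> // u u0; apply/seteqP; split=> [_ [v + <-]|w].
  rewrite /= !in_itv /= => /andP[v0 vu].
  have [/linear_bundle[L TL] T0] := Tpos.
  rewrite T0//= -vl_subr_ge0.
  have := T0 (u - v); rewrite TL raddfB.
  by apply; rewrite vl_subr_ge0.
rewrite /= in_itv /= => /andP[w0 wu].
have [v [v0 vu <-]] := lift u w u0 w0 wu.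
by exists v => //; rewrite /= in_itv /= v0.
Qed.

(** Absolute values are positive, so 0 is always a lower bound; only its being the greatest one is
    at stake. *)
Lemma order_continuousP T :
  (forall A (w : F), decreases_to_zero A ->
     (forall x, A x -> w <= vl_abs (T x)) -> w <= 0) ->
  order_continuous T.
Proof.
move=> H A A0; split; first by move=> _ [x _ <-]; exact: vl_abs_ge0.
by move=> w lbw; apply: (H A) => // x Ax; apply: lbw; exists x.
Qed.

(* If [w] is below all [T x], then so is [vl_pos w], which lies in the image of
   an interval; as [T] reflects the order, its preimage is a lower bound. *)
Lemma inj_interval_preserving_order_continuous T :
  lattice_homomorphism T -> interval_preserving T -> injective T ->
  order_continuous T.
Proof.
move=> Thom Tint Tinj; apply: order_continuousP => A w A0 wlb.
have Aabs x : A x -> vl_abs (T x) = T x.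
  move=> Ax; rewrite -lattice_hom_vl_abs// vl_abs_id//.
  exact: decreases_to_zero_ge0 Ax.
have wT x : A x -> vl_pos w <= T x.
  move=> Ax; rewrite leUx -{1}Aabs// wlb//=.
  have [_ ->//] := lattice_homomorphism_positive Thom.
  exact: decreases_to_zero_ge0 Ax.
have [[a Aa] _ [_ glb]] := A0.
have [//|v [v0 _ vw]] :=
  interval_preserving_lift Tint (decreases_to_zero_ge0 A0 Aa) _ (wT a Aa).
  exact: vl_pos_ge0.
have : v <= 0.
  by apply: glb => x Ax; rewrite -(lattice_hom_inj_le _ _ Thom)// vw wT.
move=> /(lattice_hom_le Thom); rewrite vw.
have [/linear_bundle[L ->] _ _] := Thom; rewrite raddf0.
by apply: le_trans; exact: leUl.
Qed.

End LatticeHomomorphisms.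

(** * The category [NIVL] *)

Section NIVLCategory.
Variables (R : realType) (E F G : vectorLatticeType R).

Lemma NIVL_id : NIVL E E id.
Proof.
have idhom : lattice_homomorphism (@id E) by split.
split => //; last by split=> [|u u0]; [split|rewrite image_id].
apply: inj_interval_preserving_order_continuous => //.
by split=> [|u u0]; [split|rewrite image_id].
Qed.

Lemma lattice_hom_comp (S : F -> G) (T : E -> F) :
  lattice_homomorphism S -> lattice_homomorphism T ->
  lattice_homomorphism (S \o T).
Proof.
move=> [Slin SI SU] [Tlin TI TU]; split=> [a x y|x y|x y] /=.
- by rewrite Tlin Slin.
- by rewrite TI SI.
- by rewrite TU SU.
Qed.

Lemma NIVL_comp (S : F -> G) (T : E -> F) :
  NIVL _ _ S -> NIVL _ _ T -> NIVL _ _ (S \o T).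
Proof.
move=> [Shom Scont Sint] [Thom Tcont Tint].
split; first exact: lattice_hom_comp.
- move=> A A0; have := Scont (T @` A); rewrite image_comp; apply.
  have [[a Aa] dir _] := A0; split; first by exists (T a), a.
    move=> _ _ [x Ax <-] [y Ay <-]; have [z [Az zx zy]] := dir x y Ax Ay.
    by exists (T z); split; [exists z|exact: lattice_hom_le..].
  (* Since [A] consists of positive elements, [vl_abs (T u)] is [T u] there, so order continuity of
     [T] gives the infimum of the image of [A]. *)
  rewrite (_ : T @` A = [set vl_abs (T u) | u in A]); first exact: Tcont.
  apply: eq_imagel => x Ax; rewrite -lattice_hom_vl_abs// vl_abs_id//.
  exact: decreases_to_zero_ge0 Ax.
- have [_ Simg] := Sint; have [[_ Tpos] Timg] := Tint; split.
    exact: lattice_homomorphism_positive (lattice_hom_comp Shom Thom).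
  by move=> u u0; rewrite -image_comp Timg// Simg// Tpos.
Qed.

End NIVLCategory.

(** * Positive functionals *)

Section Functionals.
Variables (R : realType) (E : vectorLatticeType R).
Implicit Types (f g : order_dual E) (x y : E).

Lemma order_dual_ext f g : (forall x, f x = g x :> R) -> f = g.
Proof. by move=> fg; apply/val_inj/funext. Qed.

Lemma order_dual_ge0 f x : 0 <= f -> 0 <= x -> 0 <= f x :> R.
Proof. by move=> /order_dual_leP; exact. Qed.

Lemma order_dual_homo f x y : 0 <= f -> x <= y -> f x <= f y :> R.
Proof.
by move=> f0 xy; rewrite -subr_ge0 -order_dualB order_dual_ge0// vl_subr_ge0.
Qed.

Lemma order_dual_norm_le f x : 0 <= f -> `|f x : R| <= f (vl_abs x).
Proof.
move=> f0; rewrite ler_norml lerNl -order_dualN.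
by rewrite !order_dual_homo ?vl_abs_ge ?vl_abs_geN.
Qed.

Lemma positive_scalar_order_dual (g : E -> R^o) :
  scalar g -> (forall x, 0 <= x -> 0 <= g x :> R) -> g \in @order_dual_pred R E.
Proof.
move=> gl g0; apply/asboolP; split=> // u v.
have mono x y : x <= y -> g x <= g y :> R.
  move=> xy; have := gl 1 (y - x) x; rewrite scale1r subrK mul1r => ->.
  by rewrite lerDr g0// vl_subr_ge0.
exists (g u), (g v) => _ [x + <-]; rewrite /= !in_itv /= => /andP[ux xv].
by rewrite !mono.
Qed.

End Functionals.

(** * Adjoints of interval preserving and of surjective operators *)

Section Adjoint.
Variables (R : realType) (E F : vectorLatticeType R) (T : E -> F).
Implicit Types (phi : order_dual F) (psi : order_dual E).

Lemma adjoint_app phi x :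
  positive_operator T -> adjoint T phi x = phi (T x) :> R.
Proof. by move=> Tpos; rewrite adjointE. Qed.

Lemma adjoint_linear : positive_operator T -> linear (@adjoint R E F T).
Proof.
move=> Tpos a f g; apply: order_dual_ext => x.
by rewrite -[RHS]/(a * adjoint T f x + adjoint T g x) !adjoint_app.
Qed.

Lemma adjoint_ge0 phi : positive_operator T -> 0 <= phi -> 0 <= adjoint T phi.
Proof.
move=> Tpos phi0; apply/order_dual_leP => x x0.
by rewrite adjoint_app// order_dual_ge0//; have [_ ->] := Tpos.
Qed.

(** On the positive cone both sides are Riesz-Kantorovich suprema, of [phi] over [[0, T x]] and of
    [phi \o T] over [[0, x]]; they agree because [T] maps the second interval onto the first. *)
Lemma adjoint_pos phi : interval_preserving T ->
  adjoint T (order_dual_pos phi) = order_dual_pos (adjoint T phi).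
Proof.
move=> [Tpos Timg].
have cone x : 0 <= x ->
    adjoint T (order_dual_pos phi) x = order_dual_pos (adjoint T phi) x :> R.
  move=> x0; have [_ /(_ x x0) Tx0] := Tpos.
  rewrite adjoint_app//= !rk_fun_cone// /rk_cone -Timg// image_comp.
  by congr sup; apply: eq_imagel => y _; rewrite /= adjoint_app.
apply: order_dual_ext => x; rewrite -(vl_posB x) !order_dualB.
by rewrite !cone ?vl_pos_ge0.
Qed.

Lemma adjoint_lattice_hom :
  interval_preserving T -> lattice_homomorphism (@adjoint R E F T).
Proof.
move=> Tint; have [Tpos _] := Tint.
have [L LE] := linear_bundle (adjoint_linear Tpos).
have AD f g : adjoint T (f + g) = adjoint T f + adjoint T g.
  by rewrite LE raddfD.
have AN f : adjoint T (- f) = - adjoint T f by rewrite LE raddfN.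
(* Joins in the dual are built from [order_dual_pos], and meets from joins by negation, so
   preserving positive parts suffices. *)
have join f g : adjoint T (order_dual_join f g) =
    order_dual_join (adjoint T f) (adjoint T g).
  by rewrite /order_dual_join AD adjoint_pos// AD AN.
split=> [|f g|]; [exact: adjoint_linear| |exact: join].
rewrite -[LHS]/(adjoint T (order_dual_meet f g)).
rewrite -[RHS]/(order_dual_meet (adjoint T f) (adjoint T g)).
by rewrite /order_dual_meet AN join !AN.
Qed.

Hypothesis Tsurj : forall y, exists x, T x = y.

Lemma adjoint_inj : positive_operator T -> injective (@adjoint R E F T).
Proof.
move=> Tpos f g fg; apply: order_dual_ext => y; have [x <-] := Tsurj y.
by rewrite -!adjoint_app// fg.
Qed.

(** The kernel condition makes [psi] constant on the fibres of [T], so composing it with any section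
    [inv] of [T] gives a functional on [F]. *)
Lemma adjoint_factor psi : lattice_homomorphism T -> 0 <= psi ->
  (forall x, T x = 0 -> psi x = 0 :> R) ->
  exists phi, 0 <= phi /\ adjoint T phi = psi.
Proof.
move=> Thom psi0 ker; have Tpos := lattice_homomorphism_positive Thom.
pose inv y := projT1 (cid (Tsurj y)).
have invK y : T (inv y) = y by rewrite /inv; case: cid.
have Tlin : linear T by case: Tpos.
have TB x x' : T (x - x') = T x - T x'.
  by have [L ->] := linear_bundle Tlin; rewrite raddfB.
have psiE x x' : T x = T x' -> psi x = psi x' :> R.
  move=> Txx'; apply/eqP; rewrite -subr_eq0 -order_dualB; apply/eqP/ker.
  by rewrite TB Txx' subrr.
pose g : F -> R^o := psi \o inv.
have gT x : g (T x) = psi x by apply: psiE; rewrite invK.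
have g_dual : g \in @order_dual_pred R F.
  apply: positive_scalar_order_dual => [a y z|y y0].
    rewrite -(invK y) -(invK z) !gT -order_dual_scalar -gT; congr g.
    by rewrite Tlin.
  (* The chosen preimage of a positive [y] may fail to be positive, but its positive part is again a
     preimage of [y]. *)
  rewrite -(vl_pos_id y0) -(invK y) -lattice_hom_vl_pos// gT.
  by rewrite order_dual_ge0// vl_pos_ge0.
exists (OrderDual g_dual); split; last first.
  by apply: order_dual_ext => x; rewrite adjoint_app//= gT.
apply/order_dual_leP => y y0.
rewrite -(vl_pos_id y0) -(invK y) -lattice_hom_vl_pos//= gT.
by rewrite order_dual_ge0// vl_pos_ge0.
Qed.

(* A functional between [0] and [phi \o T] vanishes on the kernel of [T], hence
   factors through the surjection [T]: no Hahn-Banach argument is needed. *)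
Lemma adjoint_interval_preserving :
  lattice_homomorphism T -> interval_preserving (@adjoint R E F T).
Proof.
move=> Thom; have Tpos := lattice_homomorphism_positive Thom.
apply: interval_preservingP.
  by split; [exact: adjoint_linear|move=> f; exact: adjoint_ge0].
move=> f w f0 w0 wf.
have lift h : 0 <= h -> h <= adjoint T f -> exists g, 0 <= g /\ adjoint T g = h.
  move=> h0 hf; apply: adjoint_factor => // x Tx0.
  apply/eqP; rewrite -normr_le0; apply: le_trans (order_dual_norm_le _ h0) _.
  apply: le_trans (order_dual_leP _ _ hf _ (vl_abs_ge0 x)) _.
  rewrite adjoint_app// lattice_hom_vl_abs// Tx0 vl_abs_id//.
  by rewrite order_dual0.
have [g [g0 gw]] := lift w w0 wf; exists g; split=> //.
apply/order_dual_leP => y y0; have [x xy] := Tsurj y.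
rewrite -(vl_pos_id y0) -xy -lattice_hom_vl_pos// -!adjoint_app// gw.
by move/order_dual_leP: wf; apply; exact: vl_pos_ge0.
Qed.

Lemma adjoint_NIVL :
  lattice_homomorphism T -> interval_preserving T ->
  NIVL (order_dual F) (order_dual E) (@adjoint R E F T).
Proof.
move=> Thom Tint; have Tpos := lattice_homomorphism_positive Thom.
have Ahom := adjoint_lattice_hom Tint.
have Aint := adjoint_interval_preserving Thom.
split=> //; apply: inj_interval_preserving_order_continuous => //.
exact: adjoint_inj.
Qed.

End Adjoint.

Lemma adjoint_comp (R : realType) (E F G : vectorLatticeType R)
    (S : F -> G) (T : E -> F) (phi : order_dual G) :
  positive_operator S -> positive_operator T ->
  adjoint T (adjoint S phi) = adjoint (S \o T) phi.
Proof.
move=> Spos Tpos; have STpos : positive_operator (S \o T).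
  have [[Sl S0] [Tl T0]] := (Spos, Tpos).
  by split=> [a x y|x x0]; [rewrite /= Tl Sl|rewrite /= S0// T0].
by apply: order_dual_ext => x; rewrite !adjoint_app.
Qed.

(* The transition maps are bundled with the proof that they are lattice
   homomorphisms so that the canonical structures on [thread] can be inferred. *)
Record vl_inverse_system (R : realType) := VLInverseSystem {
  vlis_obj :> nat -> vectorLatticeType R ;
  vlis_map : forall m n, (n <= m)%N -> vlis_obj m -> vlis_obj n ;
  vlis_hom : forall m n (nm : (n <= m)%N), lattice_homomorphism (vlis_map nm) }.

Arguments vlis_map {R} v {m n}.
Arguments vlis_hom {R} v {m n}.

(** * The vector lattice of threads, the standard model of the inverse limit in [VL] *)

Section Threads.
Variables (R : realType) (S : vl_inverse_system R).

Record thread := Thread {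
  thread_val :> forall n, S n ;
  thread_valP : forall m n (nm : (n <= m)%N),
    vlis_map S nm (thread_val m) = thread_val n }.

HB.instance Definition _ := gen_eqMixin thread.
HB.instance Definition _ := gen_choiceMixin thread.

Implicit Types s t : thread.

Lemma thread_ext s t : (forall n, s n = t n) -> s = t.
Proof.
case: s t => [s sP] [t tP] /= st.
have {}st : s = t by apply: functional_extensionality_dep.
by subst t; congr Thread; exact: Prop_irrelevance.
Qed.

Fact thread0_subproof m n (nm : (n <= m)%N) : vlis_map S nm (0 : S m) = 0.
Proof. by case: (vlis_hom S nm) => /linear_bundle[L ->] _ _; rewrite raddf0. Qed.

Fact threadD_subproof s t m n (nm : (n <= m)%N) :
  vlis_map S nm (s m + t m) = s n + t n.
Proof.
rewrite -!(thread_valP _ nm).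
by case: (vlis_hom S nm) => /linear_bundle[L ->] _ _; rewrite raddfD.
Qed.

Fact threadN_subproof s m n (nm : (n <= m)%N) : vlis_map S nm (- s m) = - s n.
Proof.
rewrite -!(thread_valP _ nm).
by case: (vlis_hom S nm) => /linear_bundle[L ->] _ _; rewrite raddfN.
Qed.

Fact threadZ_subproof (a : R) s m n (nm : (n <= m)%N) :
  vlis_map S nm (a *: s m) = a *: s n.
Proof.
rewrite -!(thread_valP _ nm).
by case: (vlis_hom S nm) => /linear_bundle[L ->] _ _; rewrite linearZ.
Qed.

Fact threadI_subproof s t m n (nm : (n <= m)%N) :
  vlis_map S nm (s m `&` t m)%O = (s n `&` t n)%O.
Proof. by case: (vlis_hom S nm) => _ -> _; rewrite !thread_valP. Qed.

Fact threadU_subproof s t m n (nm : (n <= m)%N) :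
  vlis_map S nm (s m `|` t m)%O = (s n `|` t n)%O.
Proof. by case: (vlis_hom S nm) => _ _ ->; rewrite !thread_valP. Qed.

Definition thread0 := Thread thread0_subproof.
Definition thread_add s t := Thread (threadD_subproof s t).
Definition thread_opp s := Thread (threadN_subproof s).
Definition thread_scale a s := Thread (threadZ_subproof a s).
Definition thread_meet s t := Thread (threadI_subproof s t).
Definition thread_join s t := Thread (threadU_subproof s t).

Fact thread_addA : associative thread_add.
Proof. by move=> s t u; apply: thread_ext => n; exact: addrA. Qed.
Fact thread_addC : commutative thread_add.
Proof. by move=> s t; apply: thread_ext => n; exact: addrC. Qed.
Fact thread_add0 : left_id thread0 thread_add.
Proof. by move=> s; apply: thread_ext => n; exact: add0r. Qed.
Fact thread_addN : left_inverse thread0 thread_opp thread_add.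
Proof. by move=> s; apply: thread_ext => n; exact: addNr. Qed.

HB.instance Definition _ :=
  GRing.isZmodule.Build thread thread_addA thread_addC thread_add0 thread_addN.

Fact thread_scaleA a b s :
  thread_scale a (thread_scale b s) = thread_scale (a * b) s.
Proof. by apply: thread_ext => n; exact: scalerA. Qed.
Fact thread_scale1 : left_id 1 thread_scale.
Proof. by move=> s; apply: thread_ext => n; exact: scale1r. Qed.
Fact thread_scaleDr : right_distributive thread_scale +%R.
Proof. by move=> a s t; apply: thread_ext => n; exact: scalerDr. Qed.
Fact thread_scaleDl s : {morph thread_scale^~ s : a b / a + b}.
Proof. by move=> a b; apply: thread_ext => n; exact: scalerDl. Qed.

HB.instance Definition _ :=
  GRing.Zmodule_isLmodule.Build R thread
    thread_scaleA thread_scale1 thread_scaleDr thread_scaleDl.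

Definition thread_le s t := `[< forall n, s n <= t n >].

Fact thread_le_refl : reflexive thread_le.
Proof. by move=> s; apply/asboolP. Qed.
Fact thread_le_anti : antisymmetric thread_le.
Proof.
move=> s t /andP[/asboolP st /asboolP ts]; apply: thread_ext => n.
by apply: le_anti; rewrite st ts.
Qed.
Fact thread_le_trans : transitive thread_le.
Proof.
move=> t s u /asboolP st /asboolP tu; apply/asboolP => n.
exact: le_trans (st n) (tu n).
Qed.

HB.instance Definition _ :=
  Order.Le_isPOrder.Build ring_display thread
    thread_le_refl thread_le_anti thread_le_trans.

Fact thread_lexI s t u : (s <= thread_meet t u) = (s <= t) && (s <= u).
Proof.
apply/asboolP/andP => [stu|[/asboolP st /asboolP su] n /=].
  by split; apply/asboolP => n; have := stu n; rewrite /= lexI => /andP[].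
by rewrite lexI st su.
Qed.
Fact thread_leUx s t u : (thread_join s t <= u) = (s <= u) && (t <= u).
Proof.
apply/asboolP/andP => [stu|[/asboolP su /asboolP tu] n /=].
  by split; apply/asboolP => n; have := stu n; rewrite /= leUx => /andP[].
by rewrite leUx su tu.
Qed.
Fact thread_leD2r u s t : s <= t -> s + u <= t + u.
Proof.
by move=> /asboolP st; apply/asboolP => n; exact: (vl_leD2r _ _ _ (st n)).
Qed.
Fact thread_scale_ge0 (a : R) s : 0 <= a -> 0 <= s -> 0 <= a *: s.
Proof.
move=> a0 /asboolP s0; apply/asboolP => n; exact: (vl_scaler_ge0 _ _ a0 (s0 n)).
Qed.

HB.instance Definition _ :=
  isVectorLattice.Build R thread thread_lexI thread_leUx
    thread_leD2r thread_scale_ge0.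

Definition thread_proj n (s : thread) : S n := s n.

Lemma thread_proj_compatible :
  inverse_compatible VL (@vlis_map R S) (L := thread) thread_proj.
Proof.
split=> [n|m n nm]; first by split.
by apply/funext => s; exact: thread_valP.
Qed.

End Threads.

(** Dependent choice over a varying type, used to build threads one coordinate at a time. *)
Lemma dependent_sequence (A : nat -> Type)
    (r : forall n, A n -> A n.+1 -> Prop) :
  A 0%N -> (forall n (a : A n), exists b, r n a b) ->
  exists s : forall n, A n, forall n, r n (s n) (s n.+1).
Proof.
move=> a0 step.
pose s := nat_rect A a0 (fun n a => projT1 (cid (step n a))).
by exists s => n; rewrite /s /=; case: cid.
Qed.

(** * The inverse limit: its elements, its order and its projections *)

Section InverseLimit.
Variables (R : realType) (E_ : nat -> vectorLatticeType R).
Variable p_ : forall m n, (n <= m)%N -> E_ m -> E_ n.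
Variables (E : vectorLatticeType R) (p : forall n, E -> E_ n).
Hypothesis E_limit : is_inverse_limit VL p_ p.

Let E_hom m n (nm : (n <= m)%N) : lattice_homomorphism (p_ nm).
Proof. by case: E_limit => -[+ _] _ _; exact. Qed.

Lemma limit_hom n : lattice_homomorphism (p n).
Proof. by case: E_limit => _ [+ _] _; exact. Qed.

Let S := VLInverseSystem E_hom.

(** The universal property, applied to the space of threads, gives a map to [E] over the
    projections; its value at [t] is the required element. *)
Lemma limit_lift (t : forall n, E_ n) :
  (forall m n (nm : (n <= m)%N), p_ nm (t m) = t n) ->
  exists x, forall n, p n x = t n.
Proof.
move=> tP; have [_ _ /(_ _ _ (thread_proj_compatible S))] := E_limit.
move=> [s [[_ sP] _]]; exists (s (@Thread R S t tP)) => n.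
by have /(congr1 (@^~ (@Thread R S t tP))) := sP n.
Qed.

(* The limit embeds in the space of threads: both [id] and the composite
   [E -> thread S -> E] are the unique endomorphism of [E] over [p]. *)
Lemma limit_inj x y : (forall n, p n x = p n y) -> x = y.
Proof.
have [_ [pVL pP] univ] := E_limit.
have pthread z m n (nm : (n <= m)%N) : p_ nm (p m z) = p n z.
  by rewrite -(pP m n nm).
pose pi z := @Thread R S (fun n => p n z) (pthread z).
have pi_hom : lattice_homomorphism pi.
  by split=> [a u v|u v|u v]; apply: thread_ext => n; have [pl pI pU] := pVL n;
    [exact: pl|exact: pI|exact: pU].
have [s [[sVL sP] _]] := univ _ _ (thread_proj_compatible S).
have [r [_ rP]] := univ _ _ (conj pVL pP).
have idE : r = id by apply: rP; split=> //; split.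
have spiE : r = s \o pi.
  apply: rP; split; first exact: lattice_hom_comp.
  by move=> n; apply/funext => z; have /(congr1 (@^~ (pi z))) := sP n.
move=> xy; have pixy : pi x = pi y by apply: thread_ext.
by rewrite -[x]/(id x) -[y]/(id y) -idE spiE /= pixy.
Qed.

Lemma limit_le x y : (forall n, p n x <= p n y) -> x <= y.
Proof.
move=> xy; apply/meet_idPl/limit_inj => n; have [_ -> _] := limit_hom n.
exact/meet_idPl/xy.
Qed.

Hypothesis p_surj : forall m n (nm : (n <= m)%N) (y : E_ n),
  exists x : E_ m, p_ nm x = y.

Lemma transition_comp n m k
    (nm : (n <= m)%N) (mk : (m <= k)%N) (nk : (n <= k)%N) x :
  p_ nm (p_ mk x) = p_ nk x.
Proof.
have [[_ pp] _ _] := E_limit.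
rewrite -[LHS]/((p_ nm \o p_ mk) x) pp; congr (p_ _ x).
exact: bool_irrelevance.
Qed.

(** By the composition law [p_ nn] is idempotent, and a surjective idempotent is the identity. *)
Lemma transition_id n (nn : (n <= n)%N) x : p_ nn x = x.
Proof. by have [y <-] := p_surj nn x; exact: transition_comp. Qed.

Lemma limit_lift_succ (t : forall n, E_ n) :
  (forall n, p_ (leqnSn n) (t n.+1) = t n) -> exists x, forall n, p n x = t n.
Proof.
move=> tS; apply: limit_lift => + n; elim=> [|m IH] nm.
  by case: n nm => // nm; rewrite transition_id.
case: (ltnP m n) => [mn|nm']; last first.
  by rewrite -(IH nm') -(tS m) (transition_comp _ _ nm).
have nE : n = m.+1 by apply/eqP; rewrite eqn_leq nm.
by subst n; rewrite transition_id.
Qed.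

(* The part of the thread below [n] is forced; above [n] it is chosen
   recursively. *)
Lemma limit_lift_in (D : forall n, set (E_ n)) n (v : E_ n) :
  (forall m n (nm : (n <= m)%N) x, D m x -> D n (p_ nm x)) ->
  (forall n y, D n y -> exists x, D n.+1 x /\ p_ (leqnSn n) x = y) ->
  D n v -> exists x, (forall m, D m (p m x)) /\ p n x = v.
Proof.
move=> Dmap Dlift Dv.
pose Q m (x : E_ m) := D m x /\ forall mn : (m <= n)%N, x = p_ mn v.
pose r m (a : {x | Q m x}) (b : {x | Q m.+1 x}) :=
  p_ (leqnSn m) (sval b) = sval a.
have Q0 : Q 0%N (p_ (leq0n n) v).
  by split=> [|mn]; [exact: Dmap|congr (p_ _ v); exact: bool_irrelevance].
have step m (a : {x | Q m x}) : exists b, r m a b.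
  case: a => x [Dx xE]; rewrite /r /=.
  have [mn|nm] := ltnP m n.
    have Qx : Q m.+1 (p_ mn v).
      by split=> [|mn']; [exact: Dmap|congr (p_ _ v); exact: bool_irrelevance].
    exists (exist _ _ Qx) => /=.
    by rewrite (xE (ltnW mn)); exact: transition_comp.
  have [y [Dy yx]] := Dlift m x Dx.
  have Qy : Q m.+1 y by split=> // mn; move: (leq_trans mn nm); rewrite ltnn.
  by exists (exist _ _ Qy).
have [s sP] := dependent_sequence (exist _ _ Q0) step.
have [x xP] := limit_lift_succ sP.
exists x; split=> [m|]; rewrite xP; first by have [] := svalP (s m).
by have [_ /(_ (leqnn n)) ->] := svalP (s n); rewrite transition_id.
Qed.

Lemma limit_surj n (v : E_ n) : exists x, p n x = v.
Proof.
have [//|m y _|//|x [_ xv]] := @limit_lift_in (fun=> setT) n v; last by exists x.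
by have [x xy] := p_surj (leqnSn m) y; exists x.
Qed.

Hypothesis p_int : forall m n (nm : (n <= m)%N), interval_preserving (p_ nm).

(** The sets [D m = [0, p m u]] fit [limit_lift_in], as the transition maps preserve intervals; the
    element found lies in [[0, u]] because the order of [E] is coordinatewise. *)
Lemma limit_interval_preserving n : interval_preserving (p n).
Proof.
have pn_pos m := lattice_homomorphism_positive (limit_hom m).
apply: interval_preservingP => // u v u0 v0 vu.
have [_ [_ pP] _] := E_limit.
have pE k m (mk : (m <= k)%N) : p_ mk (p k u) = p m u by rewrite -(pP k m mk).
have [k m mk x [x0 xu]|m y [y0 yu]|//|x [xu xv]] :=
    @limit_lift_in (fun m x => 0 <= x /\ x <= p m u) n v.
- have [_ ->//] := lattice_homomorphism_positive (E_hom mk).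
  by rewrite -(pE k m mk); split=> //; exact: lattice_hom_le.
- rewrite -(pE _ _ (leqnSn m)) in yu.
  have [|x [x0 xu xy]] := interval_preserving_lift (p_int (leqnSn m)) _ y0 yu.
    by have [_ ->] := pn_pos m.+1.
  by exists x.
- exists x; split=> //; apply: limit_le => m; last by have [] := xu m.
  have [/linear_bundle[L pL] _ _] := limit_hom m.
  by have [] := xu m; rewrite pL raddf0.
Qed.

End InverseLimit.

(** * Direct limits as unions of embedded stages *)

Section DirectLimitUnion.
Variables (R : realType) (G : nat -> vectorLatticeType R).
Variable e : forall n m, (n <= m)%N -> G n -> G m.
Variables (F : vectorLatticeType R) (f : forall n, G n -> F).
Arguments f : clear implicits.
Hypothesis e_system : direct_system NIVL e.
Hypothesis f_comp : direct_compatible NIVL e f.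
Hypothesis f_inj : forall n, injective (f n).
Hypothesis f_cover : forall x, exists n y, f n y = x.

Let f_hom n : lattice_homomorphism (f n).
Proof. by case: f_comp => /(_ n)[]. Qed.

Let f0 n : f n 0 = 0.
Proof. by case: (f_hom n) => /linear_bundle[L ->] _ _; rewrite raddf0. Qed.

Let f_le n x y : (f n x <= f n y) = (x <= y).
Proof. exact: lattice_hom_inj_le. Qed.

Let f_ge0 n x : (0 <= f n x) = (0 <= x).
Proof. by rewrite -(f0 n) f_le. Qed.

(** Both elements move to the stage [maxn n m], so identities between two elements of [F] can be
    checked in a single [G n]. *)
Let cover2 x y : exists n a b, f n a = x /\ f n b = y.
Proof.
have [n [a <-]] := f_cover x; have [m [b <-]] := f_cover y.
have [_ fe] := f_comp.
exists (maxn n m), (e (leq_maxl n m) a), (e (leq_maxr n m) b).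
by rewrite -(fe _ _ (leq_maxl n m)) -(fe _ _ (leq_maxr n m)).
Qed.

Section Mediating.
Variables (L : vectorLatticeType R) (g : forall n, G n -> L).
Arguments g : clear implicits.
Hypothesis g_comp : direct_compatible NIVL e g.

(** [r] picks an arbitrary representative. Two representatives of one element coincide at a common
    stage, where [f] is injective, so their images under [g] agree. *)
Lemma mediating_exists : exists r : F -> L, forall n y, r (f n y) = g n y.
Proof.
have pre x : {n : nat & {y | f n y = x}}.
  by have [n /cid y] := cid (f_cover x); exists n.
pose r x := g _ (sval (projT2 (pre x))).
exists r => n y; rewrite /r; case: (pre _) => m [z /= zy].
have [[_ fe] [_ ge]] := (f_comp, g_comp).
rewrite -(ge _ _ (leq_maxl m n)) -(ge _ _ (leq_maxr m n)) /=; congr (g _ _).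
apply: f_inj; move: zy.
by rewrite -(fe _ _ (leq_maxl m n)) -(fe _ _ (leq_maxr m n)).
Qed.

Variable r : F -> L.
Hypothesis rf : forall n y, r (f n y) = g n y.

Let g_NIVL n : NIVL _ _ (g n).
Proof. by case: g_comp => + _; exact. Qed.

Lemma mediating_hom : lattice_homomorphism r.
Proof.
split=> [k x y|x y|x y]; have [n [a [b [<- <-]]]] := cover2 x y;
  have [fl fI fU] := f_hom n; have [[gl gI gU] _ _] := g_NIVL n.
- by rewrite -fl !rf gl.
- by rewrite -fI !rf gI.
- by rewrite -fU !rf gU.
Qed.

Lemma mediating_interval_preserving : interval_preserving r.
Proof.
apply: interval_preservingP.
  exact: lattice_homomorphism_positive mediating_hom.
move=> u w u0 w0; have [n [a au]] := f_cover u; subst u; rewrite rf => wa.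
rewrite f_ge0 in u0; have [_ _ gint] := g_NIVL n.
have [b [b0 ba bw]] := interval_preserving_lift gint u0 w0 wa.
by exists (f n b); rewrite f_ge0 f_le rf.
Qed.

(* Each [f n] identifies [G n] with an order ideal of [F], so that the part of
   [A] below one of its elements [f n a] can be pulled back to [G n]. *)
Lemma mediating_order_continuous : order_continuous r.
Proof.
apply: order_continuousP => A w A0 wlb.
have [[x0 Ax0] dir [_ glb]] := A0.
have [n [a ax0]] := f_cover x0; subst x0.
have [_ gcont _] := g_NIVL n.
have [fNIVL _] := f_comp; have [_ _ fint] := fNIVL n.
pose B := [set b | A (f n b) /\ b <= a].
have pull x : A x -> exists b, B b /\ f n b <= x.
  move=> Ax; have [z [Az zx za]] := dir _ _ Ax Ax0.
  have a0 : 0 <= a by rewrite -f_ge0; exact: decreases_to_zero_ge0 Ax0.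
  have [b [_ ba bz]] :=
    interval_preserving_lift fint a0 (decreases_to_zero_ge0 A0 Az) za.
  by exists b; rewrite /B /= bz.
have B0 : decreases_to_zero B.
  split; first by exists a; split.
    move=> x y [Ax xa] [Ay ya]; have [z [Az zx zy]] := dir _ _ Ax Ay.
    have [b [Bb bz]] := pull z Az; exists b; split=> //.
      by rewrite -f_le; exact: le_trans zx.
    by rewrite -f_le; exact: le_trans zy.
  split=> [b [Ab _]|b blb].
    by rewrite -f_ge0; exact: decreases_to_zero_ge0 Ab.
  rewrite -f_le f0; apply: glb => x Ax; have [c [Bc cx]] := pull x Ax.
  by apply: le_trans cx; rewrite f_le; exact: blb.
have [_] := gcont B B0; apply=> _ [b [Ab _] <-].
by rewrite -rf; exact: wlb.
Qed.

End Mediating.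

Lemma direct_limit_union : is_direct_limit NIVL e f.
Proof.
split=> // L g g_comp; have [r rf] := mediating_exists g_comp.
exists r; split.
  split; last by move=> n; apply/funext => y; exact: rf.
  split; [exact: (mediating_hom g_comp rf)
         |exact: (mediating_order_continuous g_comp rf)
         |exact: (mediating_interval_preserving g_comp rf)].
move=> r' [_ r'f]; apply/funext => x; have [n [y <-]] := f_cover x.
by rewrite rf -(r'f n).
Qed.

End DirectLimitUnion.

(** * Uniqueness of direct limits *)

Lemma direct_limit_iso (R : realType) (G : nat -> vectorLatticeType R)
    (e : forall n m, (n <= m)%N -> G n -> G m)
    (F F' : vectorLatticeType R) (f : forall n, G n -> F)
    (f' : forall n, G n -> F') :
  is_direct_limit NIVL e f -> is_direct_limit NIVL e f' ->
  exists T : F -> F', lattice_isomorphism T /\ forall n, T \o f n = f' n.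
Proof.
have roundtrip (K K' : vectorLatticeType R) (k : forall n, G n -> K)
    (k' : forall n, G n -> K') (r : K -> K') (s : K' -> K) :
    is_direct_limit NIVL e k -> NIVL _ _ r -> NIVL _ _ s ->
    (forall n, r \o k n = k' n) -> (forall n, s \o k' n = k n) -> cancel r s.
  (* Both [id] and [s \o r] are mediating morphisms from the cocone [k] to itself, so uniqueness
     identifies them. *)
  move=> [_ kcomp univ] rN sN rk sk'; have [t [_ tP]] := univ _ _ kcomp.
  have idE : t = id by apply: tP; split=> //; exact: NIVL_id.
  have srE : t = s \o r.
    apply: tP; split=> [|n]; first exact: NIVL_comp.
    by rewrite -compA rk sk'.
  by move=> x; rewrite -[LHS]/((s \o r) x) -srE idE.
move=> lim lim'; have [[_ fcomp univ] [_ f'comp univ']] := (lim, lim').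
have [r [[rN rf] _]] := univ _ _ f'comp.
have [s [[sN sf'] _]] := univ' _ _ fcomp.
exists r; split=> //; split; first by case: rN.
by exists s; [exact: (roundtrip _ _ f f')|exact: (roundtrip _ _ f' f)].
Qed.

(** * The dual of the inverse limit *)

Section DualOfInverseLimit.
Variables (R : realType) (E_ : nat -> vectorLatticeType R).
Variable p_ : forall m n, (n <= m)%N -> E_ m -> E_ n.
Variables (E : vectorLatticeType R) (p : forall n, E -> E_ n).
Hypothesis E_system : inverse_system IVL p_.
Hypothesis E_limit : is_inverse_limit VL p_ p.
Hypothesis p_surj : forall m n (nm : (n <= m)%N) (y : E_ n),
  exists x : E_ m, p_ nm x = y.

Let E_hom m n (nm : (n <= m)%N) : lattice_homomorphism (p_ nm).
Proof. by case: E_system => /(_ m n nm)[]. Qed.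

Let E_int m n (nm : (n <= m)%N) : interval_preserving (p_ nm).
Proof. by case: E_system => /(_ m n nm)[]. Qed.

Let p_hom := limit_hom E_limit.
Let p_int := limit_interval_preserving E_limit p_surj E_int.
Let p_onto := limit_surj E_limit p_surj.

(** The element [u] plays the role of the infinite sum of the [x i]: its [k]-th coordinate is the
    finite sum [t k], as [p k (x i)] vanishes for [i >= k]. *)
Lemma ordered_partial_sums (x : nat -> E) :
  (forall n, 0 <= x n) -> (forall n, p n (x n) = 0) ->
  exists u, forall N, \sum_(i < N) x i <= u.
Proof.
move=> x0 px0.
have [_ [_ pP] _] := E_limit.
have pk0 k i : (k <= i)%N -> p k (x i) = 0.
  move=> ki; rewrite -(pP i k ki) /= px0.
  by case: (E_hom ki) => /linear_bundle[L ->] _ _; rewrite raddf0.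
have pk_ge0 k i : 0 <= p k (x i).
  by have [_ ->] := lattice_homomorphism_positive (p_hom k).
pose t k := \sum_(i < k) p k (x i).
have [k|u uP] := @limit_lift_succ _ _ _ _ _ E_limit p_surj t.
  have sum_map G : p_ (leqnSn k) (\sum_(i < k.+1) G i) =
      \sum_(i < k.+1) p_ (leqnSn k) (G i).
    by case: (E_hom (leqnSn k)) => /linear_bundle[L ->] _ _; rewrite raddf_sum.
  (* The extra last term of [t k.+1] is sent to [p k (x k) = 0]. *)
  rewrite sum_map (eq_bigr (fun i : 'I_k.+1 => p k (x i))) => [|i _].
    by rewrite big_ord_recr /= px0 addr0.
  by rewrite -(pP _ _ (leqnSn k)).
exists u => N; apply: (limit_le E_limit) => k; rewrite uP /t.
have -> : p k (\sum_(i < N) x i) = \sum_(i < N) p k (x i).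
  by case: (p_hom k) => /linear_bundle[L ->] _ _; rewrite raddf_sum.
(* Terms from index [k] on vanish in coordinate [k], so [k] terms may be replaced by [k + N], which
   differ from the first [N] by positive terms only. *)
have <- : \sum_(i < k + N) p k (x i) = \sum_(i < k) p k (x i).
  elim: N => [|N IH]; first by rewrite addn0.
  by rewrite addnS big_ord_recr /= IH pk0 ?leq_addr// addr0.
suff mono j : \sum_(i < N) p k (x i) <= \sum_(i < N + j) p k (x i).
  by rewrite addnC.
elim: j => [|j IH]; first by rewrite addn0.
rewrite addnS big_ord_recr /= -[leLHS]addr0.
exact: (vl_leD IH (pk_ge0 _ _)).
Qed.

(* Otherwise choose [x n >= 0] in the kernel of [p n] with [phi (x n) = 1]: the
   series of the [x n] is finite in each coordinate, so that its sum exists in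
   [E] and [phi] maps it above every natural number. *)
Lemma functional_vanishes_on_kernel (phi : order_dual E) :
  0 <= phi -> exists n, forall x, p n x = 0 -> phi x = 0 :> R.
Proof.
move=> phi0; apply: contrapT => noker.
have bad n : exists x, [/\ 0 <= x, p n x = 0 & phi x = 1 :> R].
  apply: contrapT => nox; apply: noker; exists n => x px0.
  apply: contrapT => /eqP phix; apply: nox.
  have phiabs : 0 < phi (vl_abs x) :> R.
    by apply: lt_le_trans (order_dual_norm_le x phi0); rewrite normr_gt0.
  (* Passing to the absolute value gives positivity and stays in the kernel; dividing by
     [phi (vl_abs x) > 0] normalises the value. *)
  exists ((phi (vl_abs x) : R)^-1 *: vl_abs x); split.
  - by rewrite vl_scaler_ge0 ?vl_abs_ge0// invr_ge0 ltW.
  - have : p n (vl_abs x) = 0 by rewrite lattice_hom_vl_abs// px0 vl_abs_id.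
    have [/linear_bundle[L ->] _ _] := p_hom n.
    by rewrite linearZZ => ->; rewrite scaler0.
  - by rewrite order_dualZ mulVf// gt_eqF.
pose x n := projT1 (cid (bad n)).
have xP n : [/\ 0 <= x n, p n (x n) = 0 & phi (x n) = 1 :> R].
  by rewrite /x; case: cid.
have [n|n|u uP] := @ordered_partial_sums x; [by case: (xP n)..|].
have phisum N : phi (\sum_(i < N) x i) = N%:R :> R.
  elim: N => [|N IH]; first by rewrite big_ord0 order_dual0.
  by rewrite big_ord_recr /= order_dualD IH -natr1; case: (xP N) => _ _ ->.
have phiu N : N%:R <= phi u :> R by rewrite -phisum order_dual_homo.
(* The Archimedean bound of [phi u] is a natural number exceeding it, against [phiu]. *)
have := archi_boundP (phiu 0%N).
by rewrite ltNge phiu.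
Qed.

Let adjoint_p n m (nm : (n <= m)%N) psi :
  adjoint (p m) (adjoint (p_ nm) psi) = adjoint (p n) psi.
Proof.
have [_ [_ pP] _] := E_limit.
by rewrite adjoint_comp ?pP//; exact: lattice_homomorphism_positive.
Qed.

(** The positive and negative parts of [phi] each vanish on the kernel of some projection and factor
    through it; both factors are pushed to the stage [maxn n m] and subtracted. *)
Lemma dual_cover (phi : order_dual E) : exists n psi, adjoint (p n) psi = phi.
Proof.
have cover0 f : 0 <= f -> exists n psi, adjoint (p n) psi = f.
  move=> f0; have [n ker] := functional_vanishes_on_kernel f0.
  have [psi [_ psif]] := adjoint_factor (@p_onto n) (p_hom n) f0 ker.
  by exists n, psi.
have [n [a aphi]] := cover0 _ (vl_pos_ge0 phi).
have [m [b bphi]] := cover0 _ (vl_pos_ge0 (- phi)).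
pose nk := leq_maxl n m; pose mk := leq_maxr n m.
exists (maxn n m), (adjoint (p_ nk) a - adjoint (p_ mk) b).
rewrite -(vl_posB phi) -aphi -bphi -(adjoint_p nk) -(adjoint_p mk).
have := adjoint_linear (lattice_homomorphism_positive (p_hom (maxn n m))).
by move=> /linear_bundle[L ->]; rewrite raddfB.
Qed.

Lemma dual_direct_limit :
  is_direct_limit NIVL (dual_map p_) (fun n => @adjoint R E (E_ n) (p n)).
Proof.
apply: direct_limit_union.
- split=> [n m nm|n m k nm mk].
    by apply: adjoint_NIVL => //; exact: p_surj.
  apply/funext => f; rewrite /dual_map /= adjoint_comp.
  + by case: E_system => _ ->.
  + exact: lattice_homomorphism_positive.
  + exact: lattice_homomorphism_positive.
- split=> [n|n m nm]; last by apply/funext => f; exact: adjoint_p.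
  by apply: adjoint_NIVL => //; exact: p_onto.
- move=> n; apply: adjoint_inj; first exact: p_onto.
  exact: lattice_homomorphism_positive.
- exact: dual_cover.
Qed.

End DualOfInverseLimit.

Theorem theorem5p12 (R : realType) (E_ : nat -> vectorLatticeType R)
    (p_ : forall m n, (n <= m)%N -> E_ m -> E_ n)
    (E : vectorLatticeType R) (p : forall n, E -> E_ n)
    (E_system : inverse_system IVL p_)
    (E_limit : is_inverse_limit VL p_ p)
    (p_surj : forall m n (nm : (n <= m)%N) (y : E_ n),
       exists x : E_ m, p_ m n nm x = y) :
  (exists (F : vectorLatticeType R) (e : forall n, dual_obj E_ n -> F),
     is_direct_limit NIVL (dual_map p_) e) /\
  (forall (F : vectorLatticeType R) (e : forall n, dual_obj E_ n -> F),
     is_direct_limit NIVL (dual_map p_) e ->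
     exists T : F -> order_dual E,
       lattice_isomorphism T /\ forall n, T \o e n = adjoint (p n)).
Proof.
have lim := dual_direct_limit E_system E_limit p_surj.
split; first by exists (order_dual E), (fun n => adjoint (p n)).
by move=> F e Flim; exact: direct_limit_iso Flim lim.
Qed.
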